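(* Let $\mathcal D=\{0,1\}$ and let $\ell^{\mathrm{add}}(d;\boldsymbol y,\boldsymbol x)=\varpi(\boldsymbol y,\boldsymbol x)+\sum_{k\in\{0,1\}}\omega_k(d,y_k,\boldsymbol x)$ be an additive counterfactual loss, with $\omega_k:\mathcal D\times\mathcal Y\times\mathcal X\to\mathbb R$ and $\varpi:\mathcal Y^2\times\mathcal X\to\mathbb R$ bounded measurable. Define $$\ell^{\mathrm{std}}(d;y_d,\boldsymbol x)=\omega_d(d,y_d,\boldsymbol x)-\omega_d(1-d,y_d,\boldsymbol x),\qquad h(\boldsymbol y,\boldsymbol x)=\omega_0(1,y_0,\boldsymbol x)+\omega_1(0,y_1,\boldsymbol x)+\varpi(\boldsymbol y,\boldsymbol x).$$ Then: (1) $\ell^{\mathrm{add}}(d;\boldsymbol y,\boldsymbol x)=\ell^{\mathrm{std}}(d;y_d,\boldsymbol x)+h(\boldsymbol y,\boldsymbol x)$ for all $d\in\{0,1\}$, $\boldsymbol y=(y_0,y_1)\in\mathcal Y^2$, $\boldsymbol x\in\mathcal X$. (2) Consequently, for any additive counterfactual loss $\ell^{\mathrm{add}}$ there exists a standard loss $\ell^{\mathrm{std}}$ such that for every $P\in\mathcal P$ and every policy $\pi:\mathcal X\to\Delta(\mathcal D)$ the difference $R_P(\pi;\ell^{\mathrm{add}})-R_P(\pi;\ell^{\mathrm{std}})=\mathbb E_{P_{Y(\mathcal D),\boldsymbol X}}[h(Y(0),Y(1),\boldsymbol X)]$ does not depend on $\pi$. (3) The standard loss $\ell^{\mathrm{std}}$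 is unique for the property that, for every $P\in\mathcal P$, $R_P(\pi;\ell^{\mathrm{add}})-R_P(\pi;\ell^{\mathrm{std}})$ does not depend on $\pi$, up to addition of a bounded measurable function $c(\boldsymbol x)$ of the covariates only, i.e. up to replacing it by $\ell^{\mathrm{std}}_c(d;y_d,\boldsymbol x)=\ell^{\mathrm{std}}(d;y_d,\boldsymbol x)+c(\boldsymbol x)$. (4) The mapping from additive counterfactual losses to their equivalent standard losses (those with the property in (3), taken modulo addition of bounded measurable functions of the covariates) is surjective onto the set of (classes of) standard losses but not injective.
   Context: Setup. Let $\mathcal X$ be an arbitrary measurable space, $M\ge 2$ an integer, $\mathcal D=\{0,1\}$ (decisions, so $K=|\mathcal D|=2$), $\mathcal Y=\{0,\dots,M-1\}$ (outcomes). $\Delta(S)$ denotes the set of probability measures on $S$. Potential outcomes are $Y(0),Y(1)\in\mathcal Y$, with $Y(\mathcal D)=(Y(0),Y(1))$; covariates are $\boldsymbol X\in\mathcal X$; $D\in\mathcal D$ is the observed decision. Given a law $P_{Y(\mathcal D),\boldsymbol X}\in\Delta(\mathcal Y^{\mathcal D}\times\mathcal X)$ and a treatment assignment mechanism (a measurable map $e:\mathcal Y^{\mathcal D}\times\mathcal X\to\Delta(\mathcal D)$), the joint law $P=e\cdot P_{Y(\mathcal D),\boldsymbol X}$ of $(D,Y(\mathcal D),\boldsymbol X)$ is $$P(D=k,Y(\mathcal D)=\boldsymbol y,\boldsymbol X\in A)=\int_A e(k;\boldsymbol y,\boldsymbol x)\,P_{Y(\mathcal D)\mid\boldsymbol X}(Y(\mathcal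 D)=\boldsymbol y\mid\boldsymbol X=\boldsymbol x)\,dP_{\boldsymbol X}(\boldsymbol x)$$ for $A\subseteq\mathcal X$ measurable. Strong ignorability of $e$ with respect to $P_{Y(\mathcal D),\boldsymbol X}$: (a) unconfoundedness, $e(d;\boldsymbol y,\boldsymbol x)=e(d;\boldsymbol x)$ for every $d\in\mathcal D$, $P_{Y(\mathcal D),\boldsymbol X}$-a.s.; (b) overlap, $e(d;\boldsymbol x)>0$ for every $d\in\mathcal D$, $P_{\boldsymbol X}$-a.s. $\mathcal P$ is the set of all joint laws $P=e\cdot P_{Y(\mathcal D),\boldsymbol X}$ with $P_{Y(\mathcal D),\boldsymbol X}\in\Delta(\mathcal Y^{\mathcal D}\times\mathcal X)$ arbitrary and $e$ strongly ignorable with respect to it. A policy is a (measurable) map $\pi:\mathcal X\to\Delta(\mathcal D)$, written $\pi(d;\boldsymbol x)$. A counterfactual loss is a measurable function $\ell:\mathcal D\times\mathcal Y^{\mathcal D}\times\mathcal X\to\mathbb R$; all losses are assumed bounded. A standard loss is a (bounded) counterfactual loss depending on $\boldsymbol y$ only through $y_d$, written $\ell^{\mathrm{std}}(d;y_d,\boldsymbol x)$. The counterfactual risk is $$R_P(\pi;\ell)=\mathbb E_{P_{\boldsymbol X}}\Big[\sum_{d\in\mathcal D}\sum_{\boldsymbol y\in\mathcal Y^{\mathcal D}}\ell(d;\boldsymbol y,\boldsymbol X)\,\pi(d;\boldsymbol X)\,P(Y(\mathcal D)=\boldsymbol y\mid\boldsymbol X)\Big].$$ *)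

(* Defs.v *)
From HB Require Import structures.
From mathcomp Require Import all_boot all_order all_algebra.
From mathcomp Require Import all_classical all_reals all_analysis.

Set Implicit Arguments.
Unset Strict Implicit.
Unset Printing Implicit Defensive.

Import Order.TTheory GRing.Theory Num.Theory.
Import numFieldNormedType.Exports.

Local Open Scope classical_set_scope.
Local Open Scope ring_scope.

(* Decisions are [bool], with [false] for 0 and [true] for 1, so that 1 - d is
   [~~ d]; the library gives [bool] the discrete sigma-algebra. *)

(* The proof of 1 < M is an index of the type only because a [measurableType]
   must be inhabited. *)
Definition outcome (M : nat) (hM : (1 < M)%N) : Type := 'I_M.

HB.instance Definition _ M (hM : (1 < M)%N) := Finite.on (outcome hM).
HB.instance Definition _ M (hM : (1 < M)%N) :=
  isPointed.Build (outcome hM) (Ordinal (ltnW hM)).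
HB.instance Definition _ M (hM : (1 < M)%N) :=
  @isMeasurable.Build default_measure_display (outcome hM)
    discrete_measurable discrete_measurable0
    discrete_measurableC discrete_measurableU.

Definition outcomes (M : nat) (hM : (1 < M)%N) : Type :=
  {ffun bool -> outcome hM}.

HB.instance Definition _ M (hM : (1 < M)%N) := Finite.on (outcomes hM).
HB.instance Definition _ M (hM : (1 < M)%N) :=
  isPointed.Build (outcomes hM) [ffun=> point].
HB.instance Definition _ M (hM : (1 < M)%N) :=
  @isMeasurable.Build default_measure_display (outcomes hM)
    discrete_measurable discrete_measurable0
    discrete_measurableC discrete_measurableU.

HB.instance Definition _ d1 d2 (T1 : measurableType d1)
    (T2 : measurableType d2) :=
  isMeasurableFun.Build _ _ (T1 * T2)%type T2 snd measurable_snd.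

Section losses.
Context {dX : measure_display} {X : measurableType dX} {R : realType}.
Context {M : nat} {hM : (1 < M)%N}.

Definition bounded_measurable {d} {T : measurableType d} (f : T -> R) : Prop :=
  measurable_fun [set: T] f /\ [bounded f t | t in [set: T]].

Definition loss : Type := bool -> outcomes hM -> X -> R.
Definition std_loss : Type := bool -> outcome hM -> X -> R.

Definition standard_loss : set std_loss :=
  [set s | bounded_measurable
    (fun t : bool * (outcome hM * X) => s t.1 t.2.1 t.2.2)].

Definition of_std (s : std_loss) : loss := fun d y x => s d (y d) x.

Definition shift_std (s : std_loss) (c : X -> R) : std_loss :=
  fun d z x => s d z x + c x.

(* [omega k] is the k-th weight function, with arguments (d, y_k, x). *)
Definition additive_weights (omega : bool -> std_loss)
    (varpi : outcomes hM -> X -> R) : Prop :=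
  (forall k, bounded_measurable
    (fun t : bool * (outcome hM * X) => omega k t.1 t.2.1 t.2.2)) /\
  bounded_measurable (fun t : outcomes hM * X => varpi t.1 t.2).

Definition add_loss (omega : bool -> std_loss)
    (varpi : outcomes hM -> X -> R) : loss :=
  fun d y x => varpi y x + \sum_(k : bool) omega k d (y k) x.

Definition additive_loss : set loss :=
  [set l | exists omega varpi,
    additive_weights omega varpi /\ l = add_loss omega varpi].

Definition std_of_weights (omega : bool -> std_loss) : std_loss :=
  fun d z x => omega d d z x - omega d (~~ d) z x.

Definition h_of_weights (omega : bool -> std_loss)
    (varpi : outcomes hM -> X -> R) (y : outcomes hM) (x : X) : R :=
  omega false true (y false) x + omega true false (y true) x + varpi y x.

End losses.
Arguments loss {dX} X R {M} hM.
Arguments std_loss {dX} X R {M} hM.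

Section conditional_probability.
Context {dX : measure_display} {X : measurableType dX} {R : realType}.
Context {M : nat} {hM : (1 < M)%N}.
Variable Q : probability (outcomes hM * X)%type R.

Definition law_X : probability X R := distribution Q snd.

Definition slice (y : outcomes hM) (A : set X) : \bar R := Q ([set y] `*` A).

Section slice_measure.
Variable y : outcomes hM.

Let measurable_slice (A : set X) :
  measurable A -> measurable ([set y] `*` A).
Proof. by move=> mA; exact: measurableX. Qed.

Let slice0 : slice y set0 = 0%E.
Proof. by rewrite /slice setX0 measure0. Qed.

Let slice_ge0 A : (0 <= slice y A)%E.
Proof. exact: measure_ge0. Qed.

Let slice_sigma_additive : semi_sigma_additive (slice y).
Proof.
move=> F mF tF mUF; rewrite /slice setX_bigcupr.
apply: measure_semi_sigma_additive.
- by move=> n; exact: measurable_slice.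
- apply/trivIsetP => i j _ _ ij; rewrite -setXI setIid.
  by move/trivIsetP : tF => /(_ _ _ Logic.I Logic.I ij) ->; rewrite setX0.
- by rewrite -setX_bigcupr; exact: measurable_slice.
Qed.

HB.instance Definition _ := isMeasure.Build _ _ _
  (slice y) slice0 slice_ge0 slice_sigma_additive.

Let slice_fin : fin_num_fun (slice y).
Proof. by move=> A mA; apply: fin_num_measure; exact: measurable_slice. Qed.

HB.instance Definition _ := Measure_isFinite.Build _ _ _ (slice y) slice_fin.

End slice_measure.

(* A version of Q(Y = y | X = x): the density of A |-> Q(Y = y, X \in A) with
   respect to the law of X, which dominates that measure. *)
Definition cond_prob (y : outcomes hM) (x : X) : R :=
  fine (Radon_Nikodym (charge_of_finite_measure (slice y)) law_X x).

End conditional_probability.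

(* A measurable map into the probability measures on decisions is a probability
   kernel to [bool]; [prob k t d] is the mass k(d; t). *)
Definition prob {d} {T : measurableType d} {R : realType}
  (k : R.-pker T ~> bool) (t : T) (a : bool) : R := fine (k t [set a]).

Section laws.
Context {dX : measure_display} {X : measurableType dX} {R : realType}.
Context {M : nat} {hM : (1 < M)%N}.

Definition joint_law (e : R.-pker (outcomes hM * X) ~> bool)
    (Q : probability (outcomes hM * X)%type R)
    (P : probability (bool * (outcomes hM * X))%type R) : Prop :=
  forall k y A, measurable A ->
    P ([set k] `*` ([set y] `*` A)) =
    (\int[law_X Q]_(x in A) (prob e (y, x) k * cond_prob Q y x)%:E)%E.

(* [eX] is the function e(d; x) of the covariates with which e(d; y, x) agrees
   almost surely. *)
Definition strongly_ignorable (e : R.-pker (outcomes hM * X) ~> bool)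
    (Q : probability (outcomes hM * X)%type R) : Prop :=
  exists eX : R.-pker X ~> bool,
    (forall d, {ae Q, forall t, prob e t d = prob eX t.2 d}) /\
    (forall d, {ae law_X Q, forall x, 0 < prob eX x d}).

Definition laws : set (probability (bool * (outcomes hM * X))%type R) :=
  [set P | exists e Q, strongly_ignorable e Q /\ joint_law e Q P].

Definition law_YX (P : probability (bool * (outcomes hM * X))%type R) :
  probability (outcomes hM * X)%type R := distribution P snd.

(* For a bounded measurable [l] the integrand is integrable, so the risks of
   bounded losses are finite and their differences below are genuine. *)
Definition risk (P : probability (bool * (outcomes hM * X))%type R)
    (pi : R.-pker X ~> bool) (l : loss X R hM) : \bar R :=
  'E_(law_X (law_YX P))[fun x =>
    \sum_(d : bool) \sum_(y : outcomes hM)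
      l d y x * prob pi x d * cond_prob (law_YX P) y x].

Definition same_risk_up_to_policy (l : loss X R hM) (s : std_loss X R hM) :
    Prop :=
  forall P, laws P -> forall pi pi' : R.-pker X ~> bool,
    (risk P pi l - risk P pi (of_std s) =
     risk P pi' l - risk P pi' (of_std s))%E.

Definition equivalent_std (l : loss X R hM) : set (std_loss X R hM) :=
  [set s | standard_loss s /\ same_risk_up_to_policy l s].

Definition std_class (s : std_loss X R hM) : set (std_loss X R hM) :=
  [set s' | exists2 c : X -> R, bounded_measurable c & s' = shift_std s c].

End laws.

(* Main.v *)
Require Import Defs.
From HB Require Import structures.
From mathcomp Require Import all_boot all_order all_algebra.
From mathcomp Require Import all_classical all_reals all_analysis.
From mathcomp Require Import measurable_realfun ring lra.

Set Implicit Arguments.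
Unset Strict Implicit.
Unset Printing Implicit Defensive.

Import Order.TTheory GRing.Theory Num.Theory.
Import numFieldNormedType.Exports.

Local Open Scope classical_set_scope.
Local Open Scope ring_scope.

(** With two decisions, omega_k(d, y_k) is always omega_k(1 - k, y_k), plus the
    difference omega_k(k, y_k) - omega_k(1 - k, y_k) if d = k.  The first part
    ignores d and is collected in h; the second one involves the outcome y_d
    only, so it is a standard loss.  This is [add_lossE].

    To pass from losses to risks, [riskE] writes the risk as an expectation
    under the joint law of outcomes and covariates, of the loss averaged over
    the decision.  It rests on [expectation_disintegration], which sums the
    change of variables formula for the density Q(Y = y | X = .) over the
    finitely many y.  Since the probabilities of the two decisions sum to 1, a
    term of the loss that ignores d contributes its expectation, whatever the
    policy ([risk_diff]).  Hence the risks of l^add and of l^std + c differ by a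
    quantity that does not involve the policy.

    Conversely, let s be a standard loss with this property.  The law under
    which (Y, X) is a point mass at (y, x) and D is an independent fair coin is
    strongly ignorable ([laws_coin_flip]), and under it the constant policy d
    has risk l(d; y, x) ([risk_dirac]).  Comparing the two constant policies
    shows that s - l^std takes the same value at (0, y_0, x) and (1, y_1, x).
    As y_0 and y_1 vary independently, it is a function of x alone.

    So the equivalent standard losses of an additive loss form exactly one
    class ([equivalent_std_add]).  Every class is reached, because omega_k may
    be supported on d = k, where it is an arbitrary standard loss; and two
    additive losses that differ by a constant varpi reach the same class. *)

(** * Bounded measurable functions *)

Section bounded_measurable_functions.
Context {R : realType} {d : measure_display} {T : measurableType d}.
Implicit Types f g : T -> R.

Lemma bounded_measurableP f :
  bounded_measurable f <->
  measurable_fun [set: T] f /\ exists C, forall t, `|f t| <= C.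
Proof.
split=> -[mf bf]; split=> //.
- have [C [_ fC]] := bf; exists (`|C| + 1) => t.
  by apply: fC => //; rewrite ltr_pwDr// ler_norm.
- have [C fC] := bf; exists C; split; first exact: num_real.
  by move=> r Cr t _ /=; exact: le_trans (fC t) (ltW Cr).
Qed.

Lemma bounded_measurable_cst (r : R) : bounded_measurable (fun _ : T => r).
Proof.
by apply/bounded_measurableP; split; [exact: measurable_cst|exists `|r|].
Qed.

Lemma bounded_measurableD f g :
  bounded_measurable f -> bounded_measurable g ->
  bounded_measurable (fun t => f t + g t).
Proof.
move=> /bounded_measurableP[mf [C fC]] /bounded_measurableP[mg [D gD]].
apply/bounded_measurableP; split; first exact: measurable_funD.
by exists (C + D) => t; rewrite (le_trans (ler_normD _ _))// lerD.
Qed.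

Lemma bounded_measurableM f g :
  bounded_measurable f -> bounded_measurable g ->
  bounded_measurable (fun t => f t * g t).
Proof.
move=> /bounded_measurableP[mf [C fC]] /bounded_measurableP[mg [D gD]].
apply/bounded_measurableP; split; first exact: measurable_funM.
by exists (C * D) => t; rewrite normrM ler_pM.
Qed.

Lemma bounded_measurableB f g :
  bounded_measurable f -> bounded_measurable g ->
  bounded_measurable (fun t => f t - g t).
Proof.
move=> bf bg; under eq_fun do rewrite -mulN1r.
by apply: bounded_measurableD => //; apply: bounded_measurableM => //;
  exact: bounded_measurable_cst.
Qed.

Lemma bounded_measurable_sum (I : Type) (s : seq I) (F : I -> T -> R) :
  (forall i, bounded_measurable (F i)) ->
  bounded_measurable (fun t => \sum_(i <- s) F i t).
Proof.
move=> bF; elim: s => [|i s ih].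
  by under eq_fun do rewrite big_nil; exact: bounded_measurable_cst.
by under eq_fun do rewrite big_cons; exact: bounded_measurableD.
Qed.

Lemma bounded_measurable_integrable (mu : {finite_measure set T -> \bar R})
    (A : set T) f :
  measurable A -> bounded_measurable f -> mu.-integrable A (EFin \o f).
Proof.
move=> mA [mf [C [rC fC]]]; apply: measurable_bounded_integrable => //.
- by rewrite ltey_eq fin_num_measure.
- exact: measurable_funTS.
- by exists C; split=> // r Cr t _; exact: fC.
Qed.

End bounded_measurable_functions.

Lemma bounded_measurable_comp (R : realType) d (T : measurableType d)
    d' (T' : measurableType d') (phi : T' -> T) (f : T -> R) :
  measurable_fun [set: T'] phi -> bounded_measurable f ->
  bounded_measurable (fun t => f (phi t)).
Proof.
move=> mphi /bounded_measurableP[mf [C fC]].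
by apply/bounded_measurableP; split; [exact: measurableT_comp|exists C].
Qed.

(** A discrete finite factor can be removed: preimages are finite unions of
    rectangles, and finitely many bounds have a common one.  All the losses
    have outcomes and decisions as such factors, so they can be handled one
    section at a time. *)
Lemma bounded_measurable_sections (R : realType) d (T : measurableType d)
    d' (U : measurableType d') (f : T * U -> R) :
  finite_set [set: T] -> (forall t : T, measurable [set t]) ->
  bounded_measurable f <->
  forall t, bounded_measurable (fun u => f (t, u)).
Proof.
move=> finT mT; split=> [bf t|bf].
  by apply: bounded_measurable_comp bf; exact: pair1_measurable.
apply/bounded_measurableP; split.
  move=> _ B mB; rewrite setTI.
  rewrite (_ : _ @^-1` _ =
      \bigcup_(t in [set: T]) ([set t] `*` ((fun u => f (t, u)) @^-1` B))).
    apply: fin_bigcup_measurable => // t _; apply: measurableX => //.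
    have /bounded_measurableP[mft _] := bf t.
    by rewrite -[X in measurable X]setTI; exact: mft.
  apply/seteqP; split=> [[t u] Bf|[t u] [_ _ [/= <- Bu]]//].
  by exists t.
have /choice[C fC] : forall t, exists C, forall u, `|f (t, u)| <= C.
  by move=> t; have /bounded_measurableP[] := bf t.
have /finite_seqP[s sT] := finT.
exists (\sum_(t <- s) `|C t|) => -[t u].
have ts : t \in s by have : [set: T] t by []; rewrite sT.
rewrite (big_rem t)//= (le_trans (fC t u))// (le_trans (ler_norm _))// lerDl.
exact: sumr_ge0.
Qed.

(** * Disintegration along the covariates *)

Section disintegration.
Context {dX : measure_display} {X : measurableType dX} {R : realType}.
Context {M : nat} {hM : (1 < M)%N}.
Variable Q : probability (outcomes hM * X)%type R.
Implicit Types (y : outcomes hM) (A : set X).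

Lemma slice_dominated y : slice Q y `<< law_X Q.
Proof.
apply/null_content_dominatesP => A mA QA0.
apply/eqP; rewrite eq_le measure_ge0 andbT.
rewrite -QA0; apply: le_measure; rewrite ?inE.
- exact: measurableX.
- by rewrite -[X in measurable X]setTI; apply: measurable_snd.
- by move=> t [].
Qed.

Lemma cond_probE y x : (cond_prob Q y x)%:E =
  Radon_Nikodym (charge_of_finite_measure (slice Q y)) (law_X Q) x.
Proof.
rewrite /cond_prob fineK//; apply: Radon_Nikodym_fin_num.
exact: slice_dominated.
Qed.

Lemma integrable_cond_prob y (g : X -> R) : bounded_measurable g ->
  (law_X Q).-integrable [set: X] (EFin \o (fun x => g x * cond_prob Q y x)).
Proof.
move=> [mg bg]; rewrite [X in _.-integrable _ X](_ : _ = (EFin \o g) \*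
    Radon_Nikodym (charge_of_finite_measure (slice Q y)) (law_X Q))%E.
  apply: integrableMr => //; apply: Radon_Nikodym_integrable.
  exact: slice_dominated.
by apply/funext => x /=; rewrite EFinM cond_probE.
Qed.

Lemma integral_cond_prob y A (g : X -> R) :
    measurable A -> bounded_measurable g ->
  (\int[law_X Q]_(x in A) (g x * cond_prob Q y x)%:E =
   \int[slice Q y]_(x in A) (g x)%:E)%E.
Proof.
move=> mA bg; under eq_integral do rewrite EFinM cond_probE.
apply: (@Radon_Nikodym_change_of_variables _ _ _ _ _ _ (EFin \o g)) => //.
- exact: slice_dominated.
- exact: bounded_measurable_integrable.
Qed.

(** On the rectangle {y} x X, the law Q coincides with the image of its slice
    under x |-> (y, x). *)
Lemma integral_slice y (g : outcomes hM * X -> R) : bounded_measurable g ->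
  (\int[slice Q y]_x (g (y, x))%:E =
   \int[Q]_(t in [set y] `*` setT) (g t)%:E)%E.
Proof.
move=> bg; have my : measurable ([set y] `*` [set: X]) by exact: measurableX.
have mp : measurable_fun [set: X] (pair y) by exact: pair1_measurable.
rewrite [RHS](eq_measure_integral (pushforward (slice Q y) (pair y))).
  rewrite integral_pushforward//.
  - by rewrite (_ : _ @^-1` _ = setT)//; apply/seteqP; split.
  - by apply/measurable_EFinP; case: bg.
  - apply: (@bounded_measurable_integrable _ _ _ _ _ (g \o pair y)).
      by rewrite -[X in measurable X]setTI; exact: mp.
    exact: bounded_measurable_comp bg.
move=> A mA Ay; rewrite /pushforward /slice/=; congr (Q _).
apply/seteqP; split=> [[y' x] Ayx|[y' x] [/= ->]//].
by have [/= yy' _] := Ay _ Ayx; split=> //=; rewrite /preimage/= -yy'.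
Qed.

(** The rectangles {y} x X partition the space, and on each of them the
    integral of g against Q is that of g(y, .) against the slice at y, whose
    density with respect to the law of X is the conditional probability. *)
Lemma expectation_disintegration (g : outcomes hM * X -> R) :
    bounded_measurable g ->
  ('E_(law_X Q)[fun x =>
     (\sum_(y : outcomes hM) g (y, x) * cond_prob Q y x)%R] =
   'E_Q[g])%E.
Proof.
move=> bg; rewrite unlock.
under eq_integral do rewrite -sumEFin.
rewrite integral_sum//; last first.
  move=> y; apply: (@integrable_cond_prob y (fun x => g (y, x))).
  by apply: bounded_measurable_comp bg; exact: pair1_measurable.
transitivity (\sum_(y : outcomes hM)
    \int[Q]_(t in [set y] `*` setT) (g t)%:E)%E.
  apply: eq_bigr => y _; rewrite -integral_slice// -integral_cond_prob//.
  by apply: bounded_measurable_comp bg; exact: pair1_measurable.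
rewrite -integral_bigsetU_EFin//=; first 1 last.
- by move=> y; exact: measurableX.
- exact: index_enum_uniq.
- by move=> y z _ _ [t [[<- _] [<- _]]].
- by apply: measurable_funTS; apply/measurable_EFinP; case: bg.
congr (integral _ _ _); apply/seteqP; split=> // t _.
by rewrite -bigcup_seq/=; exists t.1 => //=; exact: mem_index_enum.
Qed.

End disintegration.

(** * Policies and risks *)

Section policies.
Context {R : realType} {d : measure_display} {T : measurableType d}.
Implicit Type pi : R.-pker T ~> bool.

Lemma prob_EFin pi t a : (prob pi t a)%:E = pi t [set a].
Proof.
rewrite /prob fineK// ge0_fin_numE//.
have pia1 : (pi t [set a] <= 1)%E.
  by rewrite -(prob_kernel (s := pi) t); apply: le_measure; rewrite ?inE.
by rewrite (le_lt_trans pia1) ?ltry.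
Qed.

Lemma sum_prob pi t : \sum_(a : bool) prob pi t a = 1.
Proof.
apply/EFin_inj; rewrite big_bool EFinD !prob_EFin -measureU//.
  rewrite -(prob_kernel (s := pi) t); congr (pi t _).
  by apply/seteqP; split=> // -[] _; [left|right].
by apply/seteqP; split=> // -[] [].
Qed.

Lemma bounded_measurable_prob pi a : bounded_measurable (fun t => prob pi t a).
Proof.
apply/bounded_measurableP; split.
  apply/measurable_EFinP; rewrite (_ : _ \o _ = pi ^~ [set a]).
    exact: measurable_kernel.
  by apply/funext => t; exact: prob_EFin.
have prob_ge0 b t : 0 <= prob pi t b by rewrite /prob fine_ge0.
exists 1 => t; rewrite ger0_norm// -(sum_prob pi t) (bigD1 a)//= lerDl.
exact: sumr_ge0.
Qed.

Definition constant_policy (a : bool) : R.-pker T ~> bool :=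
  kdirac (measurable_cst a).

Lemma prob_constant_policy a t b : prob (constant_policy a) t b = (b == a)%:R.
Proof.
rewrite /prob -[constant_policy a t _]/(dirac a [set b]) diracE.
congr (nat_of_bool _)%:R.
by apply/idP/eqP => [/set_mem ->//|->]; rewrite inE.
Qed.

End policies.

Section risks.
Context {dX : measure_display} {X : measurableType dX} {R : realType}.
Context {M : nat} {hM : (1 < M)%N}.
Implicit Types (P : probability (bool * (outcomes hM * X))%type R)
  (pi : R.-pker X ~> bool) (l : loss X R hM).

Definition bounded_loss l : Prop :=
  forall d, bounded_measurable (fun t : outcomes hM * X => l d t.1 t.2).

Lemma bounded_measurable_loss_prob l pi : bounded_loss l ->
  bounded_measurable
    (fun t : outcomes hM * X => \sum_(d : bool) l d t.1 t.2 * prob pi t.2 d).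
Proof.
move=> bl; apply: bounded_measurable_sum => d; apply: bounded_measurableM => //.
apply: (bounded_measurable_comp (phi := snd)) (bounded_measurable_prob pi d).
exact: measurable_snd.
Qed.

(** Averaging the loss over the decision gives a function of (y, x), to which
    the disintegration applies; exchanging the sums over y and d puts the risk
    in the required form. *)
Lemma riskE P pi l : bounded_loss l ->
  (risk P pi l =
   'E_(law_YX P)[fun t => (\sum_(d : bool) l d t.1 t.2 * prob pi t.2 d)%R])%E.
Proof.
move=> bl; rewrite -expectation_disintegration; last first.
  exact: bounded_measurable_loss_prob.
rewrite /risk; congr expectation; apply/funext => x.
by rewrite exchange_big; apply: eq_bigr => y _; rewrite mulr_suml.
Qed.

(** The probabilities pi(d; x) sum to 1 over d, so they disappear from the
    contribution of a term [h] without d. *)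
Lemma risk_diff P pi l l' (h : outcomes hM -> X -> R) :
    bounded_loss l -> bounded_loss l' ->
    (forall d y x, l d y x = l' d y x + h y x) ->
  (risk P pi l - risk P pi l' = 'E_(law_YX P)[fun t => h t.1 t.2])%E.
Proof.
move=> bl bl' ll'h; rewrite !riskE// unlock -integralB_EFin//; last 2 first.
- apply: bounded_measurable_integrable => //.
  exact: bounded_measurable_loss_prob.
- apply: bounded_measurable_integrable => //.
  exact: bounded_measurable_loss_prob.
apply: eq_integral => t _; rewrite -EFinB; congr EFin.
rewrite -sumrB (eq_bigr (fun d => h t.1 t.2 * prob pi t.2 d)).
  by rewrite -mulr_sumr sum_prob mulr1.
by move=> d _; rewrite -mulrBl ll'h addrAC subrr add0r.
Qed.

(** A point mass together with a constant policy reads off one value of the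
    loss: an identity between risks is thereby turned into an identity at every
    point, not only almost everywhere. *)
Lemma risk_dirac P y x d l : bounded_loss l ->
    (forall A, measurable A -> law_YX P A = \d_((y, x) : outcomes hM * X) A) ->
  risk P (constant_policy d) l = (l d y x)%:E.
Proof.
move=> bl PE; rewrite riskE// unlock.
rewrite (eq_measure_integral (dirac ((y, x) : outcomes hM * X))); last first.
  by move=> A mA _; exact: PE.
rewrite integral_dirac//.
  rewrite diracT mul1e; congr EFin.
  rewrite (bigD1 d)//= big1 ?addr0 ?prob_constant_policy ?eqxx ?mulr1//.
  by move=> a /negbTE ad; rewrite prob_constant_policy ad mulr0.
apply/measurable_EFinP.
by have [] := bounded_measurable_loss_prob (constant_policy d) bl.
Qed.

End risks.

(** * Fair randomization of the decision *)

Section coin_flip_law.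
Context {dX : measure_display} {X : measurableType dX} {R : realType}.
Context {M : nat} {hM : (1 < M)%N}.
Variable Q : probability (outcomes hM * X)%type R.

Local Notation coin := (bernoulli_prob (2^-1 : R)).

Lemma coin_set1 (a : bool) : coin [set a] = (2^-1)%:E.
Proof.
have half : 0 <= (2^-1 : R) <= 1 by rewrite invr_ge0 ler0n invf_le1 ?ler1n.
rewrite bernoulli_probE// !diracE.
rewrite !classical_sets.in_set1.
case: a => /=; rewrite ?mule0 ?mule1 ?adde0 ?add0e//.
by congr EFin; rewrite -[LHS]/(1 - 2^-1) {1}(splitr 1) div1r addrK.
Qed.

(** The decision is a fair coin independent of outcomes and covariates: the
    simplest strongly ignorable mechanism, available for every [Q]. *)
Definition coin_flip_law := (coin \x Q)%E.

HB.instance Definition _ := Measure.on coin_flip_law.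

Let coin_flip_setT : coin_flip_law setT = 1%E.
Proof.
rewrite /coin_flip_law -setXTT [LHS]product_measure1E//.
by rewrite [X in (X * _)%E]probability_setT
  [X in (_ * X)%E]probability_setT mule1.
Qed.

HB.instance Definition _ :=
  Measure_isProbability.Build _ _ _ coin_flip_law coin_flip_setT.

Lemma law_YX_coin_flip A : measurable A -> law_YX coin_flip_law A = Q A.
Proof.
move=> mA; rewrite /law_YX /distribution /pushforward /=.
rewrite (_ : _ @^-1` _ = setT `*` A); last first.
  by apply/seteqP; split=> // -[a t] [].
by rewrite [LHS]product_measure1E// [X in (X * _)%E]probability_setT mul1e.
Qed.

Lemma laws_coin_flip : laws coin_flip_law.
Proof.
pose e : R.-pker (outcomes hM * X) ~> bool :=
  kprobability (measurable_cst (coin : pprobability bool R)).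
pose eX : R.-pker X ~> bool :=
  kprobability (measurable_cst (coin : pprobability bool R)).
have eE t a : prob e t a = 2^-1 by rewrite /prob /= /kprobability coin_set1.
have eXE t a : prob eX t a = 2^-1 by rewrite /prob /= /kprobability coin_set1.
exists e, Q; split.
  exists eX; split=> d; apply: aeW => t; first by rewrite eE eXE.
  by rewrite eXE invr_gt0.
move=> k y A mA; under eq_integral do rewrite eE.
rewrite integral_cond_prob//; last exact: bounded_measurable_cst.
rewrite integral_cst// [LHS]product_measure1E//; last exact: measurableX.
by congr (_ * _)%E; exact: coin_set1.
Qed.

End coin_flip_law.

(** * The equivalent standard losses of an additive loss *)

Section equivalent_standard_losses.
Context {dX : measure_display} {X : measurableType dX} {R : realType}.
Context {M : nat} {hM : (1 < M)%N}.
Implicit Types (s : std_loss X R hM) (omega : bool -> std_loss X R hM)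
  (varpi : outcomes hM -> X -> R).

Lemma standard_lossP s :
  standard_loss s <-> forall d z, bounded_measurable (s d z).
Proof.
rewrite /standard_loss /= (bounded_measurable_sections
  (fun t : bool * (outcome hM * X) => s t.1 t.2.1 t.2.2)
  finite_finset (fun=> I)).
have sectionsE d := bounded_measurable_sections
  (fun t : outcome hM * X => s d t.1 t.2) finite_finset (fun=> I).
split=> bs d; first exact: (iffLR (sectionsE d) (bs d)).
exact: (iffRL (sectionsE d) (bs d)).
Qed.

Lemma bounded_measurable_std_outcome s d k : standard_loss s ->
  bounded_measurable (fun t : outcomes hM * X => s d (t.1 k) t.2).
Proof.
move=> bs; apply/(bounded_measurable_sections
  (fun t : outcomes hM * X => s d (t.1 k) t.2) finite_finset (fun=> I)).
by move=> y; move/standard_lossP : bs; exact.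
Qed.

Lemma bounded_loss_of_std s : standard_loss s -> bounded_loss (of_std s).
Proof. by move=> bs d; exact: bounded_measurable_std_outcome. Qed.

Lemma bounded_loss_add omega varpi :
  additive_weights omega varpi -> bounded_loss (add_loss omega varpi).
Proof.
move=> [bomega bvarpi] d; apply: bounded_measurableD => //.
apply: bounded_measurable_sum => k.
exact: bounded_measurable_std_outcome (bomega k).
Qed.

Lemma standard_loss_of_weights omega varpi :
  additive_weights omega varpi -> standard_loss (std_of_weights omega).
Proof.
move=> [bomega _]; apply/standard_lossP => d z.
have bz k : bounded_measurable (omega d k z).
  by have /standard_lossP := bomega d; exact.
exact: bounded_measurableB (bz d) (bz (~~ d)).
Qed.

Lemma standard_loss_shift s (c : X -> R) :
  standard_loss s -> bounded_measurable c -> standard_loss (shift_std s c).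
Proof.
move=> /standard_lossP bs bc; apply/standard_lossP => d z.
exact: bounded_measurableD.
Qed.

Lemma add_lossE omega varpi d y x :
  add_loss omega varpi d y x =
  std_of_weights omega d (y d) x + h_of_weights omega varpi y x.
Proof.
rewrite /add_loss /std_of_weights /h_of_weights big_bool.
by case: d => /=; ring.
Qed.

(** Sufficiency is [risk_diff]. For necessity, the constant policies under the
    coin-flip law over a point mass at (y, x) show that s - l^std takes the same
    value at (0, y_0, x) and (1, y_1, x); varying y_0 and y_1 separately, it
    depends on x only. *)
Lemma same_risk_add_lossP omega varpi s :
    additive_weights omega varpi -> standard_loss s ->
  same_risk_up_to_policy (add_loss omega varpi) s <->
  exists2 c : X -> R, bounded_measurable c &
    s = shift_std (std_of_weights omega) c.
Proof.
move=> bw bs; have bstd := standard_loss_of_weights bw.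
split=> [same|[c bc sE] P _ pi pi'].
  have diffE y x : add_loss omega varpi false y x - s false (y false) x =
                   add_loss omega varpi true y x - s true (y true) x.
    pose Q : probability (outcomes hM * X)%type R := dirac (y, x).
    pose P : probability (bool * (outcomes hM * X))%type R := coin_flip_law Q.
    have riskP b l : bounded_loss l ->
        risk P (constant_policy b) l = (l b y x)%:E.
      by move=> bl; apply: risk_dirac => // A; exact: (law_YX_coin_flip Q).
    have := same P (laws_coin_flip Q)
      (constant_policy false) (constant_policy true).
    rewrite !riskP; try exact: bounded_loss_of_std; try exact: bounded_loss_add.
    by rewrite -!EFinB => -[].
  pose z0 : outcome hM := point.
  (* The gap s - l^std is the same at all decisions and outcomes, so c can be
     read off at an arbitrary pair. *)
  exists (fun x => s false z0 x - std_of_weights omega false z0 x).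
    apply: bounded_measurableB.
      by move/standard_lossP : bs; exact.
    by move/standard_lossP : bstd; exact.
  apply/funext => d; apply/funext => z; apply/funext => x.
  (* The term h is common to both decisions and cancels from [diffE]. *)
  have gap z' z'' : s false z' x - std_of_weights omega false z' x =
                    s true z'' x - std_of_weights omega true z'' x.
    have := diffE [ffun b => if b then z'' else z'] x.
    rewrite !add_lossE !ffunE; lra.
  rewrite /shift_std; case: d; first by rewrite (gap z0 z) addrC subrK.
  by rewrite (gap z0 z0) -(gap z z0) addrC subrK.
have diffE pi0 : (risk P pi0 (add_loss omega varpi) - risk P pi0 (of_std s) =
    'E_(law_YX P)[fun t => (h_of_weights omega varpi t.1 t.2 - c t.2)%R])%E.
  apply: (@risk_diff _ _ _ _ _ _ _ _ _
    (fun y x => h_of_weights omega varpi y x - c x)).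
  - exact: bounded_loss_add.
  - exact: bounded_loss_of_std.
  - by move=> d y x; rewrite add_lossE sE /of_std /shift_std; ring.
by rewrite !diffE.
Qed.

Lemma equivalent_std_add omega varpi : additive_weights omega varpi ->
  equivalent_std (add_loss omega varpi) = std_class (std_of_weights omega).
Proof.
move=> bw; apply/seteqP; split=> s.
  by move=> [bs /(same_risk_add_lossP bw bs)].
move=> [c bc sE]; have bs : standard_loss s.
  rewrite sE; apply: standard_loss_shift => //.
  exact: standard_loss_of_weights bw.
by split=> //; apply/(same_risk_add_lossP bw bs); exists c.
Qed.

(** This is a right inverse of [std_of_weights], so every standard loss comes
    from an additive loss. *)
Definition diagonal_weights s (k d : bool) (z : outcome hM) (x : X) : R :=
  if k == d then s d z x else 0.

Lemma additive_diagonal_weights s (varpi : outcomes hM -> X -> R) :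
  standard_loss s ->
  bounded_measurable (fun t : outcomes hM * X => varpi t.1 t.2) ->
  additive_weights (diagonal_weights s) varpi.
Proof.
move=> bs bvarpi; split=> // k; apply/standard_lossP => d z.
rewrite /diagonal_weights; case: eqP => _; last exact: bounded_measurable_cst.
by move/standard_lossP : bs; exact.
Qed.

Lemma std_of_diagonal_weights s : std_of_weights (diagonal_weights s) = s.
Proof.
apply/funext => d; apply/funext => z; apply/funext => x.
by rewrite /std_of_weights /diagonal_weights eqxx; case: d; rewrite subr0.
Qed.

End equivalent_standard_losses.

Theorem proposition1 (R : realType) (dX : measure_display)
    (X : measurableType dX) (M : nat) (hM : (1 < M)%N) :
  (forall (omega : bool -> std_loss X R hM) (varpi : outcomes hM -> X -> R),
    additive_weights omega varpi ->
    [/\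
      (* (1) *)
      forall (d : bool) (y : outcomes hM) (x : X),
        add_loss omega varpi d y x =
        std_of_weights omega d (y d) x + h_of_weights omega varpi y x,
      (* (2) *)
      standard_loss (std_of_weights omega) /\
      (forall P : probability (bool * (outcomes hM * X))%type R, laws P ->
        forall pi : R.-pker X ~> bool,
          (risk P pi (add_loss omega varpi)
           - risk P pi (of_std (std_of_weights omega)) =
           'E_(law_YX P)[fun t => h_of_weights omega varpi t.1 t.2])%E) &
      (* (3) *)
      forall s : std_loss X R hM, standard_loss s ->
        (same_risk_up_to_policy (add_loss omega varpi) s <->
         exists2 c : X -> R, bounded_measurable c &
           s = shift_std (std_of_weights omega) c)])
  /\
  (* (4) *)
  [/\ set_fun additive_loss (std_class @` standard_loss)
        (@equivalent_std dX X R M hM),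
      set_surj additive_loss (std_class @` standard_loss)
        (@equivalent_std dX X R M hM) &
      ~ set_inj additive_loss (@equivalent_std dX X R M hM)].
Proof.
split=> [omega varpi bw|]; first split.
- exact: add_lossE.
- have bstd := standard_loss_of_weights bw; split=> // P _ pi.
  apply: risk_diff; first exact: bounded_loss_add.
  + exact: bounded_loss_of_std.
  + exact: add_lossE.
- by move=> s bs; exact: same_risk_add_lossP.
split.
- move=> _ [omega [varpi [bw ->]]]; exists (std_of_weights omega).
    exact: standard_loss_of_weights bw.
  by rewrite equivalent_std_add.
- move=> _ [s bs <-].
  have bw : additive_weights (diagonal_weights s) (fun _ _ => 0).
    by apply: additive_diagonal_weights => //; exact: bounded_measurable_cst.
  exists (add_loss (diagonal_weights s) (fun _ _ => 0)).
    by exists (diagonal_weights s), (fun _ _ => 0).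
  by rewrite equivalent_std_add// std_of_diagonal_weights.
- move=> inj.
  pose omega : bool -> std_loss X R hM := fun _ _ _ _ => 0.
  pose l (r : R) := add_loss omega (fun _ _ => r).
  have bw (r : R) : additive_weights omega (fun _ _ => r).
    by split=> [k|]; exact: bounded_measurable_cst.
  have al r : additive_loss (l r) by exists omega, (fun _ _ => r).
  have l01 : l 0 = l 1.
    by apply: inj; rewrite ?inE// /l !equivalent_std_add.
  have /eqP := congr1 (fun f : loss X R hM => f true point point) l01.
  rewrite /l /add_loss /omega big1// !addr0.
  by rewrite eq_sym oner_eq0.
Qed.
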